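(* Let $S = \langle n_1, n_2, n_3\rangle$ be a numerical semigroup of embedding dimension three, and let $d = \gcd\{n_3 - n_2,\ n_2 - n_1\}$. If $|\Delta(S)| = 2$, then $\Delta(S) = \{d, 2d\}$.
   Context: $\mathbb{N} = \{0,1,2,\ldots\}$. A numerical semigroup is an additive submonoid $S$ of $\mathbb{N}$ with finite complement. Every numerical semigroup has a unique minimal generating set $\{n_1,\ldots,n_e\}$ (positive integers); $e$ is called the embedding dimension of $S$, and $S = \langle n_1,\ldots,n_e\rangle$ means that $\{n_1,\ldots,n_e\}$ is the minimal generating set of $S$. All factorizations are taken with respect to the minimal generating set. A factorization of $y \in S$ is a tuple $(a_1,\ldots,a_e) \in \mathbb{N}^e$ with $a_1 n_1 + \cdots + a_e n_e = y$; its length is $a_1+\cdots+a_e$. Let $\mathcal{L}(y) = \{\ell_1 < \ell_2 < \cdots < \ell_m\}$ be the (finite) set of lengths of factorizations of $y$. The delta set of $y$ is $\Delta(y) = \{\ell_{i+1}-\ell_i : 1 \le i \le m-1\}$, and the delta set of $S$ is $\Delta(S) = \bigcup_{y \in S} \Delta(y)$. *)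

(* Defs.v *)
From mathcomp Require Import all_boot.
From mathcomp Require Import classical_sets cardinality.

Set Implicit Arguments.
Unset Strict Implicit.
Unset Printing Implicit Defensive.

Local Open Scope classical_set_scope.
Local Open Scope card_scope.
Local Open Scope nat_scope.

Definition submonoid (S : set nat) : Prop :=
  S 0 /\ (forall x y, S x -> S y -> S (x + y)).

Definition numerical_semigroup (S : set nat) : Prop :=
  submonoid S /\ finite_set (~` S).

Definition generates (A S : set nat) : Prop := smallest submonoid A = S.

(* Minimality is with respect to inclusion; in particular 0 is never a member
   of a minimal generating set. *)
Definition minimal_generating_set (A S : set nat) : Prop :=
  generates A S /\ (forall B : set nat, B `<=` A -> generates B S -> B = A).

(* [uniq] makes [e] the embedding dimension.  The generators are listed in
   arbitrary order. *)
Definition minimal_generators e (n : e.-tuple nat) (S : set nat) : Prop :=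
  uniq n /\ minimal_generating_set [set` n] S.

Section Factorizations.
Variables (e : nat) (n : e.-tuple nat).

Definition factorizations (y : nat) : set (e.-tuple nat) :=
  [set a | \sum_(i < e) tnth a i * tnth n i = y].

Definition fact_length (a : e.-tuple nat) : nat := \sum_(i < e) tnth a i.

Definition length_set (y : nat) : set nat := fact_length @` factorizations y.

(* [l] is the increasing enumeration of the length set of [y]; it is unique, and
   it exists because an element has finitely many factorizations into positive
   generators. *)
Definition delta (y : nat) : set nat :=
  [set k | exists l : seq nat,
     [/\ sorted ltn l, [set` l] = length_set y &
         exists2 i, i.+1 < size l & k = nth 0 l i.+1 - nth 0 l i]].

Definition delta_set (S : set nat) : set nat := \bigcup_(y in S) delta y.

End Factorizations.

(* Main.v *)
Require Import Defs.
From mathcomp Require Import all_boot all_order all_algebra.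
From mathcomp Require Import boolp classical_sets cardinality zify.

Local Open Scope classical_set_scope.
Local Open Scope card_scope.
Local Open Scope nat_scope.

(** Two factorizations of the same element differ by a vector [v] of the rank
two lattice [M] of integer relations [v1 * n1 + v2 * n2 + v3 * n3 = 0], and
their lengths differ by [v1 + v2 + v3], here called the degree of [v].  The
degrees on [M] form the ideal generated by [d]: all of them are multiples of
[d] because [n1], [n2], [n3] are congruent modulo [d] and [n1] is prime to [d]
([gap_dvd]), and a Bezout combination of relations between two generators has
degree [d] ([lengths_bezout]).  So [d] is in the delta set, and a delta set with two
elements is [{d, k * d}] for some [k > 1].  The point is to exclude [k > 2].

Suppose [k > 2] and let [y] have consecutive lengths [l] and [l + k * d].
Adding a generator [n] to [y] shifts all lengths by one and may create new ones
between [l + 1] and [l + 1 + k * d].  If it does, the only available gaps being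
[d] and [k * d], the whole interval is refined into steps of size [d]; as
[k > 2], two new lengths at distance [d] appear, both realized by
factorizations in which [n] does not occur.  Their difference is a relation of
degree [d] between the other two generators, a trade.  This is [gap_shift]: in
the absence of a trade of length [d] between the other two generators, adding
[n] preserves gaps of size [k * d].

Order the generators as [p < q < r].  A trade of length [d] between [p] and [r]
forbids all gaps [k * d] with [k > 1] ([outer_trade_no_gap]).  Hence there is
none, and adding copies of [q] preserves the gap.  But a trade of length [d]
between [q] and another generator becomes applicable inside the gap once enough
copies of [q] have been added, and breaks it.  So no trade of length [d] exists
between any two generators, and adding any element of the semigroup preserves
the gap.  This contradicts the existence of an element having two lengths at
distance [d] ([wide_gap_double]). *)

(** * Lengths, gaps and trades for three generators *)

(** Three separate arguments, so that the generators can be permuted by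
rewriting. *)
Definition lengths (p q r y : nat) : set nat :=
  [set l | exists a b c, a * p + b * q + c * r = y /\ a + b + c = l].

Definition gap (L : set nat) (l e : nat) : Prop :=
  [/\ 0 < e, L l, L (l + e) & forall x, l < x < l + e -> ~ L x].

(** A relation of degree [d] between [p < r] replaces [t] copies of [r] by
[t + d] copies of [p]. *)
Definition trade (p r d : nat) : Prop := exists t, (t + d) * p = t * r.

Definition gaps_in (p q r d k : nat) : Prop :=
  forall y l e, gap (lengths p q r y) l e -> e = d \/ e = k * d.

Lemma lengthsD {p q r x y l m} : lengths p q r x l -> lengths p q r y m ->
  lengths p q r (x + y) (l + m).
Proof.
move=> [a [b [c [<- <-]]]] [a' [b' [c' [<- <-]]]].
by exists (a + a'), (b + b'), (c + c'); split; lia.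
Qed.

Lemma lengths_swap12 p q r : lengths p q r = lengths q p r.
Proof.
by apply/funext => y; apply/seteqP; split=> l [a [b [c [<- <-]]]];
  exists b, a, c; split; lia.
Qed.

Lemma lengths_swap23 p q r : lengths p q r = lengths p r q.
Proof.
by apply/funext => y; apply/seteqP; split=> l [a [b [c [<- <-]]]];
  exists a, c, b; split; lia.
Qed.

Lemma next_gap {L : set nat} {l m} : L l -> L m -> l < m ->
  exists2 e, gap L l e & l + e <= m.
Proof.
move=> Ll Lm ltlm.
have exP : exists x, (l < x) && `[< L x >].
  by exists m; rewrite ltlm; apply/asboolP.
case: (ex_minnP exP) => x /andP[ltlx /asboolP Lx] xmin.
have xm : x <= m by apply: xmin; rewrite ltlm; apply/asboolP.
exists (x - l); last by lia.
split; [lia | by [] | by rewrite subnKC // ltnW |].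
move=> z /andP[lz zx] Lz.
have xz : x <= z by apply: xmin; rewrite lz; apply/asboolP.
lia.
Qed.

(** A chain of gaps [d] and [k * d] from [l] to [l + k * d] which has an
intermediate point can only use steps [d]; the first two already stay inside
when [k > 2]. *)
Lemma split_gap {L : set nat} {d k l x} :
  (forall m e, gap L m e -> e = d \/ e = k * d) -> 2 < k ->
  L l -> L (l + k * d) -> L x -> l < x < l + k * d ->
  L (l + d) /\ L (l + 2 * d).
Proof.
move=> Lgaps k2 Ll Lkd Lx /andP[lx xkd].
have d0 : 0 < d by nia.
have [e ge e_le] := next_gap Ll Lx lx.
have ed : e = d by case: (Lgaps _ _ ge) => ?; lia.
have Ld : L (l + d) by case: ge => _ _; rewrite ed.
have dk : l + d < l + k * d by nia.
have [f gf fk] := next_gap Ld Lkd dk.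
have fd : f = d by case: (Lgaps _ _ gf) => ?; lia.
by split=> //; case: gf => _ _; rewrite fd -addnA mul2n addnn.
Qed.

(** A length that breaks the gap after adding [p] comes from a factorization
without [p], since otherwise removing [p] would break the original gap. Two such
lengths at distance [d] then differ by a trade between [q] and [r]. *)
Lemma gap_shift {p q r d k} : q < r -> 0 < d -> 2 < k ->
  gaps_in p q r d k -> ~ trade q r d ->
  forall n y l, gap (lengths p q r y) l (k * d) ->
    gap (lengths p q r (n * p + y)) (n + l) (k * d).
Proof.
move=> qr d0 k2 gaps notr; elim=> [//|n IHn] y l /IHn{IHn}.
have -> : n.+1 * p + y = p + (n * p + y) by lia.
move: (n * p + y) => {}y; rewrite addSn; move: (n + l) => {}l [e0 Ll Le nobet].
have Lp : lengths p q r p 1 by exists 1, 0, 0; split; lia.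
split=> // [||x xbet Lx]; first exact: lengthsD Lp Ll.
  by have := lengthsD Lp Le; rewrite add1n addSn.
have [L1 L2] := split_gap (gaps (p + y)) k2 (lengthsD Lp Ll)
  (lengthsD Lp Le : lengths _ _ _ _ (1 + l + k * d)) Lx xbet.
have edge m : l < m < l + k * d -> lengths p q r (p + y) m.+1 ->
    exists b c, b * q + c * r = p + y /\ b + c = m.+1.
  move=> mbet [[|a] [b [c [E1 E2]]]]; first by exists b, c; split; lia.
  by case: (nobet m mbet); exists a, b, c; split; lia.
have [|b [c [E1 E2]]] := edge (l + d) _ L1; first by nia.
have [|b' [c' [E3 E4]]] := edge (l + 2 * d) _ L2; first by nia.
(* The longer of the two [p]-free factorizations has fewer copies of [r], the
   larger generator. *)
case: notr; exists (c - c').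
have cc' : c' <= c by nia.
nia.
Qed.

(** The relations of degree zero are rational multiples of
[(r - q, p - r, q - p)], whose first and last coordinates have the same sign. A relation of degree
[k * d] is [k] times the trade [(t + d, 0, - t)] plus a relation of degree zero,
so it adds at least [k * (t + d)] copies of [p] or removes at least [k * t]
copies of [r]. Hence the trade can be undone at the long end of the gap, or
performed at the short end. *)
Lemma outer_trade_no_gap {p q r d k y l} : p < q -> q < r -> 0 < d -> 1 < k ->
  trade p r d -> ~ gap (lengths p q r y) l (k * d).
Proof.
move=> pq qr d0 k1 [t tE] [_ [a [b [c [E1 E2]]]] [a' [b' [c' [E3 E4]]]] nobet].
have [ta|tc] : t + d <= a' \/ t <= c.
- case: (leqP (t + d) a') => [|a't]; [by left | right].
  rewrite leqNgt; apply/negP => ct.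
  (* Otherwise the degree zero part has a negative first and a positive last
     coordinate. *)
  have : (a'%:Z - a%:Z - k%:Z * (t + d)%:Z <= -1)%R by nia.
  have : (c'%:Z - c%:Z + k%:Z * t%:Z >= 1)%R by nia.
  nia.
- apply: (nobet (l + k * d - d)); first by nia.
  by exists (a' - (t + d)), b', (c' + t); split; nia.
- apply: (nobet (l + d)); first by nia.
  by exists (a + (t + d)), b, (c - t); split; nia.
Qed.

(** * A second gap is twice the first *)

Lemma wide_gap_double {p q r d k y l} : p < q -> q < r -> 0 < d -> 1 < k ->
  (exists x m, lengths p q r x m /\ lengths p q r x (m + d)) ->
  gaps_in p q r d k -> gap (lengths p q r y) l (k * d) -> k = 2.
Proof.
move=> pq qr d0 k1 [x [m [Lm Lmd]]] gaps gkd.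
have [//|k2] : k = 2 \/ 2 < k by lia.
have pr := ltn_trans pq qr.
have npr : ~ trade p r d.
  by move=> tr; exact: (outer_trade_no_gap pq qr d0 k1 tr gkd).
have gaps2 : gaps_in q p r d k by rewrite /gaps_in lengths_swap12.
have shift2 n z j : gap (lengths p q r z) j (k * d) ->
    gap (lengths p q r (n * q + z)) (n + j) (k * d).
  by rewrite lengths_swap12; exact: gap_shift.
have nqr : ~ trade q r d.
  move=> [t tE].
  (* With [t + d] more copies of [q], the trade applies backwards to the long
     factorization. *)
  case: (shift2 (t + d) _ _ gkd) => _ _ _ /(_ (t + d + l + k * d - d)); apply.
    by nia.
  case: gkd => _ _ [a [b [c [E1 E2]]]] _.
  by exists a, b, (c + t); split; nia.
have npq : ~ trade p q d.
  move=> [t tE].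
  (* With [t] more copies of [q], the trade applies to the short
     factorization. *)
  case: (shift2 t _ _ gkd) => _ _ _ /(_ (t + l + d)); apply; first by nia.
  case: gkd => _ [a [b [c [E1 E2]]]] _ _.
  by exists (a + (t + d)), b, c; split; nia.
have gaps3 : gaps_in r p q d k.
  by rewrite /gaps_in lengths_swap12 lengths_swap23.
have shift3 n z j : gap (lengths p q r z) j (k * d) ->
    gap (lengths p q r (n * r + z)) (n + j) (k * d).
  by rewrite lengths_swap23 lengths_swap12; exact: gap_shift.
(* Adding [x] generator by generator preserves the gap, while the two lengths of
   [x] at distance [d] put a length inside it. *)
have [a [b [c [xE mE]]]] := Lm.
have := gap_shift qr d0 k2 gaps nqr a _ _ (shift2 b _ _ (shift3 c _ _ gkd)).
have -> : a * p + (b * q + (c * r + y)) = x + y by lia.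
have -> : a + (b + (c + l)) = m + l by lia.
case: gkd => _ Ll _ _ [_ _ _ /(_ (m + d + l))]; case; first by nia.
exact: lengthsD.
Qed.

Lemma wide_gap_double_uniq {p q r d k y l} :
  uniq [:: p; q; r] -> 0 < d -> 1 < k ->
  (exists x m, lengths p q r x m /\ lengths p q r x (m + d)) ->
  gaps_in p q r d k -> gap (lengths p q r y) l (k * d) -> k = 2.
Proof.
wlog pq : p q r / p < q => [hw|].
  have [pq|qp|->] := ltngtP p q; first exact: hw; last by rewrite /= !inE eqxx.
  move=> U; rewrite /gaps_in lengths_swap12; apply: hw => //.
  by move: U; rewrite /= !inE; lia.
wlog qr : p q r pq / q < r => [hw|_]; last exact: wide_gap_double.
have [qr|rq|->] := ltngtP q r; first exact: hw; last first.
  by rewrite /= !inE eqxx andbF.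
move=> U; rewrite /gaps_in lengths_swap23.
have [pr|rp|E] := ltngtP p r.
- by apply: hw => //; move: U; rewrite /= !inE; lia.
- by rewrite lengths_swap12; apply: hw => //; move: U; rewrite /= !inE; lia.
- by move: U; rewrite E /= !inE eqxx orbT.
Qed.

(** * Delta sets as sets of gaps *)

Lemma length_setE p q r y : length_set [tuple p; q; r] y = lengths p q r y.
Proof.
apply/seteqP; split=> [l [a aE <-]|l [a [b [c [yE <-]]]]].
  exists (tnth a ord0), (tnth a (lift ord0 ord0)), (tnth a ord_max).
  have max3 : lift ord0 (lift ord0 ord0) = ord_max :> 'I_3 by apply/val_inj.
  move: aE; rewrite /factorizations /fact_length /=.
  rewrite !big_ord_recl !big_ord0 max3.
  rewrite (tnth_nth 0 [tuple p; q; r]) /= !(tnth_nth 0 [tuple p; q; r]) /=.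
  by split; lia.
exists [tuple a; b; c].
  by rewrite /factorizations /= !big_ord_recl big_ord0 !(tnth_nth 0) /=; lia.
by rewrite /fact_length !big_ord_recl big_ord0 !(tnth_nth 0) /=; lia.
Qed.

Lemma sorted_ltn_nth_mono {s : seq nat} : sorted ltn s ->
  {in [pred i | i < size s] &, {mono nth 0 s : i j / i < j}}.
Proof. by move=> srt; apply: (Order.POrderTheory.lt_sorted_ltn_nth 0). Qed.

(** The bound makes the length set finite, so that it has an increasing
enumeration. *)
Lemma deltaE e (n : e.-tuple nat) y N :
  (forall l, length_set n y l -> l <= N) ->
  delta n y = [set k | exists l, gap (length_set n y) l k].
Proof.
move=> bound; apply/seteqP.
split=> [k [s [srt sE [i si kE]]]|k [l [k0 Ll Lk nobet]]].
  have memE x : length_set n y x <-> x \in s by rewrite -sE.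
  have mono := sorted_ltn_nth_mono srt.
  have i0 : i < size s by exact: ltnW.
  have ltk : nth 0 s i < nth 0 s i.+1 by rewrite mono.
  have {}kE : nth 0 s i + k = nth 0 s i.+1 by lia.
  exists (nth 0 s i); split; rewrite ?kE; [lia | | |].
  - by apply/memE/mem_nth.
  - by apply/memE/mem_nth.
  move=> x ixi /memE xs; move: ixi; rewrite -(nth_index 0 xs).
  by rewrite !mono ?inE ?index_mem //; lia.
pose s := [seq x <- iota 0 N.+1 | `[< length_set n y x >]].
have memE x : length_set n y x <-> x \in s.
  rewrite mem_filter mem_iota; split=> [Lx|/andP[/asboolP//]].
  by rewrite asboolT //= add0n ltnS bound.
have srt : sorted ltn s.
  by apply: sorted_filter; [exact: ltn_trans | exact: iota_ltn_sorted].
have mono := sorted_ltn_nth_mono srt.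
exists s; split=> //; first by apply/seteqP; split=> x /= /memE.
move/memE: (Ll) => ls; move/memE: (Lk) => ks.
have is_ : index l s < size s by rewrite index_mem.
have js : index (l + k) s < size s by rewrite index_mem.
have ij : index l s < index (l + k) s.
  by rewrite -mono ?inE // !nth_index //; lia.
exists (index l s); first exact: leq_ltn_trans js.
have [lt1|gt1|->] := ltngtP (index l s).+1 (index (l + k) s); last 2 first.
- by move: gt1 ij; lia.
- by rewrite !nth_index //; lia.
have s1 := ltn_trans lt1 js.
case: (nobet (nth 0 s (index l s).+1)); last by apply/memE/mem_nth.
have lo : nth 0 s (index l s) < nth 0 s (index l s).+1 by rewrite mono.
have hi : nth 0 s (index l s).+1 < nth 0 s (index (l + k) s) by rewrite mono.
by rewrite !nth_index // in lo hi; rewrite lo.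
Qed.

(** * Generators of a numerical semigroup *)

(** Every submonoid contains zero, so a zero generator could be dropped. *)
Lemma minimal_generators_gt0 {e} {n : e.-tuple nat} {S} :
  minimal_generators n S -> forall x, x \in n -> 0 < x.
Proof.
move=> [_ [gen min]] x xn; rewrite lt0n; apply/eqP => x0.
have notin : [set` n] `\ x `<=` [set` n] by move=> ? [].
have : ([set` n] `\ x) x.
  rewrite (min _ notin) //= -gen /generates /smallest.
  congr (\bigcap_(A in _) A); apply/seteqP; split=> T [subT nT]; split=> // z.
    move=> zn; have [->|zx] := eqVneq z x; first by case: subT; rewrite x0.
    by apply: nT; split=> //; apply/eqP.
  by move=> [zn _]; exact: nT.
by case=> _; exact.
Qed.

Lemma generatedE {p q r S y} : minimal_generators [tuple p; q; r] S ->
  S y <-> exists l, lengths p q r y l.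
Proof.
move=> [_ [gen _]]; rewrite -gen; split.
  suff sub : smallest submonoid [set` [tuple p; q; r]] `<=`
      [set x | exists l, lengths p q r x l] by exact: sub.
  apply: smallest_sub; first split.
  - by exists 0, 0, 0, 0.
  - by move=> x z [l Ll] [m Lm]; exists (l + m); exact: lengthsD.
  move=> x /=; rewrite !inE => /or3P[] /eqP ->; exists 1.
  - by exists 1, 0, 0; split; lia.
  - by exists 0, 1, 0; split; lia.
  - by exists 0, 0, 1; split; lia.
move=> [l [a [b [c [<- _]]]]] T [[T0 TD] nT].
have TM m x : x \in [:: p; q; r] -> T (m * x).
  move=> xn; elim: m => [|m IHm]; first by rewrite mul0n.
  by rewrite mulSn; apply: (TD) => //; exact: nT.
by apply: (TD); [apply: (TD)|]; apply: TM; rewrite !inE eqxx ?orbT.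
Qed.

(** The semigroup contains two consecutive integers, hence a common divisor
divides [1]. *)
Lemma common_divisor_eq1 {p q r S} :
  numerical_semigroup S -> minimal_generators [tuple p; q; r] S ->
  forall g, g %| p -> g %| q -> g %| r -> g = 1.
Proof.
move=> [_ cofin] gen g gp gq gr.
have dvdS y : S y -> g %| y.
  by move=> /(generatedE gen)[_ [a [b [c [<- _]]]]];
    rewrite !dvdn_add // dvdn_mull.
have [N SN] : exists N, forall y, N <= y -> S y.
  have /finite_seqP[s sE] := cofin.
  exists (\max_(x <- s) x).+1 => y Ny.
  apply: contrapT => nSy; have : y \in s by have : (~` S) y by []; rewrite sE.
  by move=> ys; have := leq_bigmax_seq y (F := id) ys isT; rewrite /= leqNgt Ny.
apply/eqP; rewrite -dvdn1 -(dvdn_addr 1 (dvdS N _)) ?addn1; last exact: SN.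
by apply: dvdS; apply: SN.
Qed.

Lemma lengths_bounded {p q r y l} : 0 < p -> 0 < q -> 0 < r ->
  lengths p q r y l -> l <= y.
Proof. by move=> p0 q0 r0 [a [b [c [<- <-]]]]; nia. Qed.

(** If [d = u * (r - q) + v * (q - p)], then the combination of the relations
[(0, r, - q)] and [(q, - p, 0)] with coefficients [u] and [v] has degree [d];
its negative and positive parts are two factorizations of one element. *)
Lemma lengths_bezout {p q r d : nat} :
  (d%:Z = gcdz (r%:Z - q%:Z) (q%:Z - p%:Z))%R ->
  exists x l, lengths p q r x l /\ lengths p q r x (l + d).
Proof.
move=> dE.
have [u [v uvE]] := Bezoutz (r%:Z - q%:Z)%R (q%:Z - p%:Z)%R.
rewrite -dE in uvE.
pose P (x : int) := `|Num.max x 0|%N.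
pose M (x : int) := `|Num.max (- x)%R 0|%N.
have PM x : (x = (P x)%:Z - (M x)%:Z)%R by rewrite /P /M; lia.
set x1 := (v * q%:Z)%R; set x2 := (u * r%:Z - v * p%:Z)%R.
set x3 := (- (u * q%:Z))%R.
have E0 : (x1 * p%:Z + x2 * q%:Z + x3 * r%:Z = 0)%R by rewrite /x1 /x2 /x3; lia.
have Ed : (x1 + x2 + x3 = d%:Z)%R by rewrite /x1 /x2 /x3; lia.
exists (M x1 * p + M x2 * q + M x3 * r), (M x1 + M x2 + M x3).
rewrite (PM x1) (PM x2) (PM x3) in E0 Ed.
split; first by exists (M x1), (M x2), (M x3).
by exists (P x1), (P x2), (P x3); split; lia.
Qed.

(** Modulo [d] the three generators are equal, so a relation of degree [e] gives
[p * e = 0]; and [p] is prime to [d] because a common divisor of [p] and [d]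
divides all three generators. *)
Lemma gap_dvd {p q r d y l e : nat} :
  (d%:Z = gcdz (r%:Z - q%:Z) (q%:Z - p%:Z))%R ->
  (forall g, g %| p -> g %| q -> g %| r -> g = 1) ->
  lengths p q r y l -> lengths p q r y (l + e) -> d %| e.
Proof.
move=> dE cop [a [b [c [E1 E2]]]] [a' [b' [c' [E3 E4]]]].
have /dvdzP[u uE] : (d%:Z %| (r%:Z - q%:Z)%R)%Z by rewrite dE dvdz_gcdl.
have /dvdzP[v vE] : (d%:Z %| (q%:Z - p%:Z)%R)%Z by rewrite dE dvdz_gcdr.
have dvdn_of_int (g n : nat) (w : int) : (n%:Z = w * g%:Z)%R -> g %| n.
  move=> nE; suff : (g%:Z %| n%:Z)%Z by rewrite dvdzE.
  by apply/dvdzP; exists w.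
have dpe : d %| p * e.
  apply: (dvdn_of_int _ _ (v * (b%:Z - b'%:Z) + (u + v) * (c%:Z - c'%:Z))%R).
  nia.
suff cdp : coprime d p by rewrite Gauss_dvdr in dpe.
have /dvdnP[d1 d1E] := dvdn_gcdl d p; have /dvdnP[p1 p1E] := dvdn_gcdr d p.
rewrite /coprime; move: (gcdn d p) d1E p1E => g d1E p1E.
apply/eqP; apply: cop.
- by apply/dvdnP; exists p1.
- by apply: (dvdn_of_int _ _ (v * d1%:Z + p1%:Z)%R);
  rewrite GRing.mulrDl -GRing.mulrA -!PoszM -d1E -p1E; lia.
- by apply: (dvdn_of_int _ _ ((u + v) * d1%:Z + p1%:Z)%R);
  rewrite GRing.mulrDl -GRing.mulrA -!PoszM -d1E -p1E; lia.
Qed.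

(** * The delta set *)

Lemma card2_other {T : Type} {A : set T} {x : T} :
  A #= `I_2 -> A x -> exists2 y, y <> x & A = [set x; y].
Proof.
move=> /eq_cardSP[u Au /eq_cardSP[v [Av vu]]].
rewrite II0 card_eq0 => /eqP A0 Ax.
have Auv z : A z -> z = u \/ z = v.
  move=> Az; apply: contrapT => /not_orP[zu zv].
  by have : ((A `\ u) `\ v) z by []; rewrite A0.
have [xE|xE] := Auv x Ax; [exists v | exists u]; rewrite xE //; try exact/nesym.
  apply/seteqP; split=> z; first exact: Auv.
  by case=> ->.
apply/seteqP; split=> z; first by move=> /Auv[]; [right | left].
by case=> ->.
Qed.

Theorem theorem6 (S : set nat) (n1 n2 n3 d : nat)
  (hS : numerical_semigroup S)
  (hgen : minimal_generators [tuple n1; n2; n3] S)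
  (hd : (d%:Z = gcdz (n3%:Z - n2%:Z) (n2%:Z - n1%:Z))%R)
  (hcard : delta_set [tuple n1; n2; n3] S #= `I_2) :
  delta_set [tuple n1; n2; n3] S = [set d; 2 * d].
Proof.
have n1_gt0 := minimal_generators_gt0 hgen n1.
have n2_gt0 := minimal_generators_gt0 hgen n2.
have n3_gt0 := minimal_generators_gt0 hgen n3.
rewrite !inE !eqxx ?orbT /= in n1_gt0 n2_gt0 n3_gt0.
have DE k : delta_set [tuple n1; n2; n3] S k <->
    exists y l, gap (lengths n1 n2 n3 y) l k.
  have dE y : delta [tuple n1; n2; n3] y =
      [set k | exists l, gap (lengths n1 n2 n3 y) l k].
    rewrite -length_setE; apply: (@deltaE _ _ _ y) => l.
    by rewrite length_setE; apply: lengths_bounded; auto.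
  split=> [[y _]|[y [l kgap]]]; first by rewrite dE => -[l kgap]; exists y, l.
  exists y; last by rewrite dE; exists l.
  by apply/(generatedE hgen); exists l; case: kgap.
have U : uniq [:: n1; n2; n3] by case: hgen.
have d0 : 0 < d.
  suff : d != 0 by lia.
  apply/eqP => dz; move/eqP: hd; rewrite dz eq_sym gcdz_eq0.
  by move: U; rewrite /= !inE; lia.
have coprime_gens := common_divisor_eq1 hS hgen.
have ex_d := lengths_bezout hd.
have Dd : delta_set [tuple n1; n2; n3] S d.
  have [y [l [Ll Ld]]] := ex_d.
  apply/DE; exists y, l.
  have [|e egap ed] := next_gap Ll Ld; first by lia.
  suff -> : d = e by [].
  case: egap => e0 Le Lle _; have de := gap_dvd hd coprime_gens Le Lle.
  by have := dvdn_leq e0 de; lia.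
have [e ed DeltaE] := card2_other hcard Dd.
have [y [l egap]] : exists y l, gap (lengths n1 n2 n3 y) l e.
  by apply/DE; rewrite DeltaE; right.
have /dvdnP[k kE] : d %| e.
  by case: egap => _ Le Lle _; exact: gap_dvd hd coprime_gens Le Lle.
have k1 : 1 < k by case: egap => e0 _ _ _; case: k kE => [|[|k]] kE; lia.
have gaps : gaps_in n1 n2 n3 d k.
  move=> z m f fgap; rewrite -kE.
  have : delta_set [tuple n1; n2; n3] S f by apply/DE; exists z, m.
  by rewrite DeltaE.
rewrite kE in egap.
by rewrite DeltaE kE (wide_gap_double_uniq U d0 k1 ex_d gaps egap).
Qed.
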